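(* Let $F$ be a field of characteristic not two and let $E$ be a finite-dimensional vector space over $F$ with an arbitrary symmetric bilinear form $(U,V)\mapsto U\cdot V$. Suppose the non-null triangle $\overline{UVW}$ in $E$ has spreads $s_U=s(UV,UW)$, $s_V=s(VW,VU)$ and $s_W=s(WU,WV)$. Then $$(s_U+s_V+s_W)^2=2\left(s_U^2+s_V^2+s_W^2\right)+4s_Us_Vs_W.$$
   Context: Elements of $E$ are called points or vectors. The quadrance between points $U$ and $V$ is $Q(U,V)=(V-U)\cdot(V-U)$. The line $UV$ through distinct points $U,V$ is null if $Q(U,V)=0$, and non-null otherwise. A triangle $\overline{UVW}$ is a set of three distinct non-collinear points; it is non-null when each of the lines $UV$, $VW$, $UW$ is non-null. The spread between non-null lines $UW$ and $VZ$ is $$s(UW,VZ)=1-\frac{\left((W-U)\cdot(Z-V)\right)^2}{Q(U,W)\,Q(V,Z)},$$ which depends only on the two lines. The bilinear form is not assumed non-degenerate. *)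

(* Defs.v *)
From HB Require Import structures.
From mathcomp Require Import all_boot all_order all_algebra.
Set Implicit Arguments.
Unset Strict Implicit.
Unset Printing Implicit Defensive.
Import GRing.Theory.
Local Open Scope ring_scope.

Section SymmetricFormGeometry.

(* The form [dot] may be degenerate. *)
Variables (F : fieldType) (E : vectType F) (dot : {symmetric E}).
Implicit Types A B U V W X Z : E.

Definition quadrance U V : F := dot (V - U) (V - U).

(* A genuine line only when U != V. *)
Definition line U V : {pred E} := [pred X | X - U \in <[V - U]>%VS].

Definition collinear U V W : Prop :=
  exists A B, A != B /\ [/\ U \in line A B, V \in line A B & W \in line A B].

Definition triangle U V W : Prop :=
  [/\ U != V, V != W, U != W & ~ collinear U V W].

(* The line UV is represented by the pair of points U, V; for U != V this
   depends only on the line. *)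
Definition null_line U V : Prop := quadrance U V = 0.

Definition nonnull_triangle U V W : Prop :=
  triangle U V W /\ [/\ ~ null_line U V, ~ null_line V W & ~ null_line U W].

(* [spread U W V Z] is the spread between the lines UW and VZ; it is
   meaningful only when both lines are non-null. *)
Definition spread U W V Z : F :=
  1 - dot (W - U) (Z - V) ^+ 2 / (quadrance U W * quadrance V Z).

End SymmetricFormGeometry.

(* Main.v *)
Require Import Defs.
From HB Require Import structures.
From mathcomp Require Import all_boot all_order all_algebra.
From mathcomp Require Import ring.
Set Implicit Arguments.
Unset Strict Implicit.
Unset Printing Implicit Defensive.
Import GRing.Theory.
Local Open Scope ring_scope.

(** This is the triple spread formula of rational trigonometry. Write [a], [b],
    [d] for the quadrances of the sides [UV], [UW], [VW] and
    [D = a b - ((V - U) . (W - U))^2] for the Gram determinant of two edge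
    vectors. Since [D] does not depend on the vertex at which the edges are
    taken ([gram_rot]), each spread is [D] over the product of the two adjacent
    quadrances ([spread_vertex]):
      [s_U = D / (a b)], [s_V = D / (a d)], [s_W = D / (b d)].
    Thus the spreads are proportional to the opposite quadrances, with the
    common factor [k = D / (a b d)] (the spread law), and
      [s_U s_V s_W = k^2 D].
    The claimed identity is therefore [k^2] times
      [(a + b + d)^2 = 2 (a^2 + b^2 + d^2) + 4 D],
    the rational form of Heron's formula ([archimedes]), which follows from
    the polarization [d = a + b - 2 (V - U) . (W - U)]. *)

Section TripleSpread.

Variables (F : fieldType) (E : vectType F) (dot : {symmetric E}).
Implicit Types U V W : E.

(** The Gram determinant of the edges leaving [U]; up to a constant factor it
    is the square of the area of the triangle. *)
Definition gram U V W : F :=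
  quadrance dot U V * quadrance dot U W - dot (V - U) (W - U) ^+ 2.

Lemma dotC (x y : E) : dot x y = dot y x.
Proof. by rewrite hermC /= expr0 mul1r. Qed.

Lemma quadranceC U V : quadrance dot U V = quadrance dot V U.
Proof. by rewrite /quadrance -[V - U]opprB linearNl linearNr opprK. Qed.

Lemma edge_sub U V W : W - V = (W - U) - (V - U).
Proof. by rewrite opprB addrA subrK. Qed.

Lemma dot_edge U V W :
  dot (W - V) (U - V) = quadrance dot U V - dot (V - U) (W - U).
Proof.
rewrite (edge_sub U V W) -(opprB V U) /quadrance.
move: (V - U) (W - U) => x y.
by rewrite linearNr linearBl /= opprB (dotC y).
Qed.

Lemma quadrance_polar U V W :
  quadrance dot V W
    = quadrance dot U V + quadrance dot U W - 2%:R * dot (V - U) (W - U).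
Proof.
rewrite /quadrance (edge_sub U V W); move: (V - U) (W - U) => x y.
rewrite linearBl !linearBr /= (dotC y x); ring.
Qed.

(** Passing from one vertex to the next replaces the edge vectors [x, y] by
    [y - x, - x], a change of determinant 1, which preserves the Gram
    determinant. *)
Lemma gram_rot U V W : gram V W U = gram U V W.
Proof.
rewrite /gram dot_edge (quadranceC V U) (quadrance_polar U V W); ring.
Qed.

(** Archimedes' formula: for a Euclidean form over the reals, [4 D] is 16 times
    the squared area, and this is Heron's formula in terms of the squared side
    lengths. *)
Lemma archimedes U V W :
  (quadrance dot U V + quadrance dot U W + quadrance dot V W) ^+ 2
    = 2%:R * (quadrance dot U V ^+ 2 + quadrance dot U W ^+ 2
              + quadrance dot V W ^+ 2) + 4%:R * gram U V W.
Proof. rewrite (quadrance_polar U V W) /gram; ring. Qed.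

Lemma spread_vertex U V W :
    quadrance dot U V != 0 -> quadrance dot U W != 0 ->
  spread dot U V U W
    = gram U V W / (quadrance dot U V * quadrance dot U W).
Proof. by move=> a0 b0; rewrite /spread /gram mulrBl divff ?mulf_neq0. Qed.

End TripleSpread.

Theorem theorem6 (F : fieldType) (charF : 2%N \notin [pchar F])
    (E : vectType F) (dot : {symmetric E}) (U V W : E)
    (UVW : nonnull_triangle dot U V W) (sU sV sW : F)
    (sUE : sU = spread dot U V U W)
    (sVE : sV = spread dot V W V U)
    (sWE : sW = spread dot W U W V) :
  (sU + sV + sW) ^+ 2
    = 2%:R * (sU ^+ 2 + sV ^+ 2 + sW ^+ 2) + 4%:R * sU * sV * sW.
Proof.
case: UVW => _ [/eqP a0 /eqP d0 /eqP b0].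
have EU := spread_vertex a0 b0.
have EV : spread dot V W V U
    = gram dot U V W / (quadrance dot V W * quadrance dot U V).
  rewrite -(gram_rot dot U V W) (quadranceC dot U V).
  by apply: spread_vertex; rewrite // quadranceC.
have EW : spread dot W U W V
    = gram dot U V W / (quadrance dot U W * quadrance dot V W).
  rewrite (gram_rot dot W U V) (quadranceC dot U W) (quadranceC dot V W).
  by apply: spread_vertex; rewrite quadranceC.
rewrite {}sUE {}sVE {}sWE {}EU {}EV {}EW.
have := archimedes dot U V W.
move: a0 b0 d0 (gram dot U V W).
move: (quadrance dot U V) (quadrance dot U W) (quadrance dot V W).
move=> a b d a0 b0 d0 D heron.
(* The spread law: each spread is [k] times the opposite quadrance. *)
set k := D / (a * b * d).
have -> : D / (a * b) = k * d by rewrite /k; field; rewrite a0 b0 d0.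
have -> : D / (d * a) = k * b by rewrite /k; field; rewrite a0 b0 d0.
have -> : D / (b * d) = k * a by rewrite /k; field; rewrite a0 b0 d0.
have kD : k * (a * b * d) = D by rewrite divfK // !mulf_neq0.
transitivity (k ^+ 2 * (a + b + d) ^+ 2); first by ring.
by rewrite heron -kD; ring.
Qed.
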